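(* Let $\mathbb{A}$ be a unital commutative semisimple (complex) Banach algebra and let $n\in\mathbb{N}$. Then the finitely generated free $\mathbb{A}$-module $\mathbb{A}^n$ is nice.
   Context: All vector spaces are over $\mathbb{C}$, and $\mathbb{N}$ is the set of positive integers. $\mathbb{A}^n$ is the direct product of $n$ copies of $\mathbb{A}$ with the product topology (given by any of the usual equivalent product norms) and componentwise multiplication $a(a_1,\dots,a_n)=(aa_1,\dots,aa_n)$; it is a Banach $\mathbb{A}$-module. A submodule of a Banach $\mathbb{A}$-module $M$ is a linear subspace invariant under the action of $\mathbb{A}$. A Banach $\mathbb{A}$-module $M$ is called nice if every proper closed submodule of $M$ is contained in a closed submodule of $M$ of codimension $1$. Equivalently, for every proper closed submodule $N$ of $M$ there is a character on $M$ vanishing on $N$, where a character on $M$ is a non-zero continuous linear functional $\phi:M\to\mathbb{C}$ for which there is a (possibly identically zero) algebra homomorphism $\varkappa:\mathbb{A}\to\mathbb{C}$ with $\phi(am)=\varkappa(a)\phi(m)$ for all $a\in\mathbb{A}$, $m\in M$. *)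

(* Defs.v *)
From HB Require Import structures.
From mathcomp Require Import all_boot all_order all_algebra.
From mathcomp Require Import all_classical all_reals interval_inference topology normedtype.
From mathcomp Require Import complex.
Set Implicit Arguments.
Unset Strict Implicit.
Unset Printing Implicit Defensive.
Import Order.TTheory GRing.Theory Num.Theory.
Import numFieldNormedType.Exports.

Local Open Scope classical_set_scope.
Local Open Scope ring_scope.
Local Open Scope complex_scope.

(* Unital commutative Banach algebras over K.  Norms of K-normed modules take
   values in K; for K = R[i] these are the nonnegative real elements.  The
   normalisation `|1| = 1 is not required.  This is a record rather than an HB
   structure because HB rejects joins of the ring and normed module
   hierarchies: the ring structure is put on the alias comBanachAlg_carrier. *)
Record comBanachAlg (K : numFieldType) := ComBanachAlg {
  cba_space : completeNormedModType K;
  cba_one : cba_space;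
  cba_mul : cba_space -> cba_space -> cba_space;
  cba_mulA : associative cba_mul;
  cba_mulC : commutative cba_mul;
  cba_mul1 : left_id cba_one cba_mul;
  cba_mulDl : left_distributive cba_mul +%R;
  cba_one_neq0 : cba_one != 0;
  cba_scaleAl : forall (k : K) x y, k *: cba_mul x y = cba_mul (k *: x) y;
  cba_norm_mul : forall x y, `|cba_mul x y| <= `|x| * `|y|
}.

Definition comBanachAlg_carrier (K : numFieldType) (A : comBanachAlg K) : Type :=
  cba_space A.
Coercion comBanachAlg_carrier : comBanachAlg >-> Sortclass.

Section ComBanachAlgTheory.
Variables (K : numFieldType) (A : comBanachAlg K).

HB.instance Definition _ := CompleteNormedModule.copy A (cba_space A).
HB.instance Definition _ := GRing.Zmodule_isComNzRing.Build A
  (@cba_mulA K A) (@cba_mulC K A) (@cba_mul1 K A) (@cba_mulDl K A)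
  (@cba_one_neq0 K A).
HB.instance Definition _ := GRing.Lmodule_isLalgebra.Build K A
  (@cba_scaleAl K A).
HB.instance Definition _ := GRing.Lalgebra_isComAlgebra.Build K A.

Fact normrM_le (x y : A) : `|x * y| <= `|x| * `|y|.
Proof. exact: cba_norm_mul. Qed.

End ComBanachAlgTheory.

Section Semisimple.
Variable A : comNzRingType.

Definition is_ideal (I : set A) : Prop :=
  [/\ I 0, (forall a b, I a -> I b -> I (a + b))
    & (forall a b, I b -> I (a * b))].

Definition is_maximal_ideal (I : set A) : Prop :=
  [/\ is_ideal I, I <> setT
    & forall J, is_ideal J -> J <> setT -> I `<=` J -> J = I].

Definition semisimple : Prop :=
  \bigcap_(I in is_maximal_ideal) I = [set 0].

End Semisimple.

(* The A-action is an explicit function, since the carrier already has the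
   scaling of a K-vector space.  It is not required to be unital. *)
Record banachModule (K : numFieldType) (A : comBanachAlg K) := BanachModule {
  bmod_sort :> completeNormedModType K;
  act : A -> bmod_sort -> bmod_sort;
  actDl : forall a b m, act (a + b) m = act a m + act b m;
  actZl : forall (k : K) a m, act (k *: a) m = k *: act a m;
  actDr : forall a m p, act a (m + p) = act a m + act a p;
  actZr : forall (k : K) a m, act a (k *: m) = k *: act a m;
  actM : forall a b m, act (a * b) m = act a (act b m);
  act_bounded : exists c : K, forall a m, `|act a m| <= c * (`|a| * `|m|)
}.

Section Nice.
Variables (K : numFieldType) (A : comBanachAlg K) (M : banachModule A).

Definition is_submodule (N : set M) : Prop :=
  [/\ N 0, (forall x y, N x -> N y -> N (x + y)),
      (forall (k : K) x, N x -> N (k *: x))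
    & (forall (a : A) x, N x -> N (act a x))].

(* The class of v is a basis of the quotient space M / N. *)
Definition codim1 (N : set M) : Prop :=
  exists v : M, forall m : M, exists! k : K, N (m - k *: v).

Definition nice : Prop :=
  forall N : set M, is_submodule N -> closed N -> N <> setT ->
  exists P : set M,
    [/\ is_submodule P, closed P, codim1 P & N `<=` P].

End Nice.

(* The carrier of A^n is that of 'rV[A]_n, with its product topology, but
   regarded as a K-vector space (the scaling of 'rV[A]_n is by A). *)
Definition freemod (K : numFieldType) (A : comBanachAlg K) (n : nat) : Type :=
  'rV[A]_n.

Section FreeModule.
Variables (K : numFieldType) (A : comBanachAlg K) (n : nat).
Local Notation F := (freemod A n).
Implicit Types (x y : F) (a b : A) (k : K).

HB.instance Definition _ := GRing.Zmodule.copy F 'rV[A]_n.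
HB.instance Definition _ := Complete.copy F 'rV[A]_n.
HB.instance Definition _ := PseudoMetric.copy F 'rV[A]_n.

Definition fm_scale k x : F := \row_i (k *: x ord0 i).

Fact fm_scaleA k l x : fm_scale k (fm_scale l x) = fm_scale (k * l) x.
Proof. by apply/rowP => i; rewrite !mxE scalerA. Qed.

Fact fm_scale1 : left_id 1 fm_scale.
Proof. by move=> x; apply/rowP => i; rewrite !mxE scale1r. Qed.

Fact fm_scaleDr : right_distributive fm_scale +%R.
Proof. by move=> k x y; apply/rowP => i; rewrite !mxE scalerDr. Qed.

Fact fm_scaleDl x : {morph fm_scale^~ x : k l / k + l}.
Proof. by move=> k l; apply/rowP => i; rewrite !mxE scalerDl. Qed.

HB.instance Definition _ := GRing.Zmodule_isLmodule.Build K F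
  fm_scaleA fm_scale1 fm_scaleDr fm_scaleDl.

Definition fm_norm x : K := (\big[Num.max/0%:nng]_i `|x ord0 i|%:nng)%:num.

Fact fm_norm_ge0 x : 0 <= fm_norm x.
Proof. by rewrite /fm_norm. Qed.

Fact fm_norm_coord x i : `|x ord0 i| <= fm_norm x.
Proof. by rewrite /fm_norm -[leLHS]nngE num_le; exact: le_bigmax. Qed.

Fact fm_norm_le x (c : K) :
  0 <= c -> (forall i, `|x ord0 i| <= c) -> fm_norm x <= c.
Proof.
move=> /nonnegP[{}c] xc; rewrite /fm_norm num_le; apply/bigmax_leP.
by split=> [|i _]; rewrite -num_le //=.
Qed.

Fact fm_norm_lt x (c : K) :
  0 < c -> (forall i, `|x ord0 i| < c) -> fm_norm x < c.
Proof.
move=> /[dup] /ltW/nonnegP[{}c] c0 xc; rewrite /fm_norm num_lt.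
by apply/bigmax_ltP; split=> [|i _]; rewrite -num_lt //=.
Qed.

Fact fm_normD x y : fm_norm (x + y) <= fm_norm x + fm_norm y.
Proof.
apply: fm_norm_le => [|i]; first by rewrite addr_ge0 ?fm_norm_ge0.
by rewrite mxE (le_trans (ler_normD _ _))// lerD// fm_norm_coord.
Qed.

Fact fm_norm_eq0 x : fm_norm x = 0 -> x = 0.
Proof.
move=> x0; apply/rowP => i; rewrite mxE; apply/eqP; rewrite -normr_le0 -x0.
exact: fm_norm_coord.
Qed.

Fact fm_normZ k x : fm_norm (k *: x) = `|k| * fm_norm x.
Proof.
have le l z : fm_norm (l *: z) <= `|l| * fm_norm z.
  apply: fm_norm_le => [|i]; first by rewrite mulr_ge0 ?fm_norm_ge0.
  by rewrite mxE normrZ ler_wpM2l// fm_norm_coord.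
apply/eqP; rewrite eq_le le /=; have [->|k0] := eqVneq k 0.
  by rewrite normr0 mul0r fm_norm_ge0.
have := le k^-1 (k *: x); rewrite scalerA mulVf// scale1r normfV.
by rewrite ler_pdivlMl ?normr_gt0.
Qed.

Fact fm_normN x : fm_norm (- x) = fm_norm x.
Proof. by rewrite -scaleN1r fm_normZ normrN1 mul1r. Qed.

Fact fm_normMn x m : fm_norm (x *+ m) = fm_norm x *+ m.
Proof. by rewrite -scaler_nat fm_normZ normr_nat mulr_natl. Qed.

HB.instance Definition _ := Num.Zmodule_isNormed.Build K F
  fm_normD fm_norm_eq0 fm_normMn fm_normN.

Fact fm_norm_ball : @ball K F = ball_ (fun x : F => `|x|).
Proof.
rewrite /ball_ predeq3E => x e y; split=> [[e0 xey]|/= xey].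
  apply: fm_norm_lt => // i; rewrite !mxE.
  by have := xey ord0 i; rewrite -ball_normE.
split; first exact: le_lt_trans xey.
move=> i j; rewrite (ord1 i) -ball_normE /=.
by apply: le_lt_trans xey; have := fm_norm_coord (x - y) j; rewrite !mxE.
Qed.

HB.instance Definition _ := NormedZmod_PseudoMetric_eq.Build K F fm_norm_ball.
HB.instance Definition _ :=
  PseudoMetricNormedZmod_Lmodule_isNormedModule.Build K F fm_normZ.

Definition fm_act a x : F := \row_i (a * x ord0 i).

Fact fm_actDl a b x : fm_act (a + b) x = fm_act a x + fm_act b x.
Proof. by apply/rowP => i; rewrite !mxE mulrDl. Qed.

Fact fm_actZl k a x : fm_act (k *: a) x = k *: fm_act a x.
Proof. by apply/rowP => i; rewrite !mxE scalerAl. Qed.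

Fact fm_actDr a x y : fm_act a (x + y) = fm_act a x + fm_act a y.
Proof. by apply/rowP => i; rewrite !mxE mulrDr. Qed.

Fact fm_actZr k a x : fm_act a (k *: x) = k *: fm_act a x.
Proof. by apply/rowP => i; rewrite !mxE scalerAr. Qed.

Fact fm_actM a b x : fm_act (a * b) x = fm_act a (fm_act b x).
Proof. by apply/rowP => i; rewrite !mxE mulrA. Qed.

Fact fm_act_bounded :
  exists c : K, forall a x, `|fm_act a x| <= c * (`|a| * `|x|).
Proof.
exists 1 => a x; rewrite mul1r; apply: fm_norm_le => [|i]; first by rewrite mulr_ge0 ?fm_norm_ge0.
by rewrite mxE (le_trans (normrM_le _ _))// ler_wpM2l// fm_norm_coord.
Qed.

Definition free_module : banachModule A :=
  @BanachModule K A (freemod A n : completeNormedModType K) fm_act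
    fm_actDl fm_actZl fm_actDr fm_actZr fm_actM fm_act_bounded.

End FreeModule.

(* Main.v *)
(* By Zorn's lemma a proper submodule of the finitely generated module A^n lies
   in a maximal one, P.  For v outside P, I = {a | a v in P} is a maximal ideal
   of A which kills A^n / P.  By the Gelfand-Mazur theorem A = I + C.1, so the
   class of v spans A^n / P; and since |chi a| <= |a| for the character chi with
   kernel I, the functional sum_i chi(x_i) c_i with kernel P is bounded, whence
   P is closed.

   The Gelfand-Mazur theorem is proved without complex integration: if a - k is
   invertible modulo I for every k, the quotient norm g(k) of its inverse attains
   a positive maximum, because 1/g is 1-Lipschitz and coercive.  Averaging the
   resolvent over n-th roots of unity shows that g is equal to its maximum on a
   disc of fixed radius around any maximum point, hence along a whole half-line,
   which contradicts g -> 0 at infinity. *)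
Require Import Defs.
From mathcomp Require Import all_boot all_order all_algebra.
From mathcomp Require Import all_classical all_reals interval_inference topology normedtype.
From mathcomp Require Import sequences derive cyclic separable cyclotomic.
From mathcomp Require Import complex ring lra.
Set Implicit Arguments.
Unset Strict Implicit.
Unset Printing Implicit Defensive.
Import Order.TTheory GRing.Theory Num.Theory.
Import numFieldNormedType.Exports.
Local Open Scope classical_set_scope.
Local Open Scope ring_scope.
Local Open Scope complex_scope.
Import ComplexField.Normc.

(** * Roots of unity, and minima of coercive functions on the complex plane *)

Lemma primitive_root_exists (F : numClosedFieldType) n :
  (0 < n)%N -> exists z : F, n.-primitive_root z.
Proof.
move=> n_gt0; have [r Dp] := closed_field_poly_normal ('X^n - 1 : {poly F}).
rewrite (monicP _) ?monicXnsubC // scale1r in Dp.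
have rn1: all n.-unity_root r by apply/allP=> z; rewrite -root_prod_XsubC -Dp.
have sz_r: (n < (size r).+1)%N by rewrite -(size_prod_XsubC r id) -Dp size_XnsubC.
have [|z] := hasP (has_prim_root n_gt0 rn1 _ sz_r); last by exists z.
by rewrite -separable_prod_XsubC -Dp separable_Xn_sub_1 // pnatr_eq0 -lt0n.
Qed.

(** Multiplied by [w ^+ i - 1], which is nonzero, the geometric sum telescopes to
    [w ^+ (n * i) - 1 = 0]. *)
Lemma sum_prim_root_exp (F : fieldType) n i (w : F) :
  n.-primitive_root w -> (0 < i < n)%N -> \sum_(j < n) w ^+ (j * i) = 0.
Proof.
move=> wn /andP[i0 ni]; have wi1 : w ^+ i - 1 != 0.
  by rewrite subr_eq0 -(prim_order_dvd wn) gtnNdvd.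
apply: (mulfI wi1); rewrite mulr0.
under eq_bigr do rewrite mulnC exprM.
by rewrite -subrX1 exprAC (prim_expr_order wn) expr1n subrr.
Qed.

Lemma normc_ge0 (R : rcfType) (z : R[i]) : 0 <= normc z.
Proof. by case: z => x y; exact: sqrtr_ge0. Qed.

Lemma normc_real (R : rcfType) (x : R) : normc x%:C = `|x|.
Proof. by rewrite /= expr0n addr0 sqrtr_sqr. Qed.

(** Far from the origin, coercivity keeps [h] above [h 0], so a minimum over a large enough compact
    square is global. *)
Lemma normc_coercive_min (R : realType) (h : R[i] -> R) (c C : R) :
  0 < c -> (forall k l, h k - h l <= normc (k - l)) ->
  (forall k, c * (normc k - C) <= h k) -> exists k, forall l, h k <= h l.
Proof.
move=> c0 hlip hco.
(* Beyond the radius [L], [c * (normc l - C)] is at least [h 0]. *)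
pose L : R := Num.max 0 (h 0 / c + C).
have L0 : 0 <= L by rewrite /L le_max lexx.
have out l : L < normc l -> h 0 <= h l.
  move=> Ll; apply: le_trans (hco l).
  rewrite -ler_pdivrMl // mulrC lerBrDr; apply: le_trans (ltW Ll).
  by rewrite /L le_max lexx orbT.
pose f (z : R * R) := h (z.1 +i* z.2).
have fcont : continuous f.
  move=> z; apply/cvgrPdist_lt => e e0; near=> t.
  have dist k l : `|h k - h l| <= normc (k - l).
    rewrite ler_norml hlip andbT lerNl opprB -normcN opprB; exact: hlip.
  apply: le_lt_trans (dist _ _) _.
  have le12 (x y : R) : normc (x +i* y) <= `|x| + `|y|.
    rewrite /= -[leRHS]ger0_norm ?addr_ge0// -sqrtr_sqr ler_sqrt ?sqr_ge0//.
    by rewrite sqrrD !real_normK ?num_real// lerD2r lerDl mulrn_wge0//.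
  apply: le_lt_trans (le12 _ _) _; rewrite [e]splitr ltrD//.
    near: t; apply: (@cvgr_dist_lt _ _ _ (nbhs z) _ fst) => //.
      exact: cvg_fst.
    by rewrite divr_gt0.
  near: t; apply: (@cvgr_dist_lt _ _ _ (nbhs z) _ snd) => //.
    exact: cvg_snd.
  by rewrite divr_gt0.
have [|||k _ kmin] := @compact_EVT_min _ _ f (`[- L, L] `*` `[- L, L]).
- by exists (0, 0); split => /=; rewrite in_itv /= L0 oppr_le0 L0.
- by apply: compact_setX; exact: segment_compact.
- exact: continuous_subspaceT.
have inb l : normc l <= L -> f k <= h l.
  case: l => x y lL; apply: (kmin (x, y)).
  have [xl yl] : `|x| <= L /\ `|y| <= L.
    by split; apply: le_trans lL;
      rewrite /= -sqrtr_sqr ler_sqrt ?addr_ge0 ?sqr_ge0// ?lerDl ?lerDr sqr_ge0.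
  by rewrite inE; split => /=; rewrite in_itv /= -ler_norml.
exists (k.1 +i* k.2) => l; have [/inb//|/out] := leP (normc l) L.
by apply: le_trans; apply: inb; rewrite normc0.
Unshelve. all: by end_near. Qed.

(** * The Gelfand-Mazur theorem *)

Section SeminormedAlgebra.
Variables (R : realType) (A : comAlgType R[i]) (p : A -> R).
Hypotheses (pD : forall x y, p (x + y) <= p x + p y)
  (pZ : forall k x, p (k *: x) = normc k * p x)
  (pM : forall x y, p (x * y) <= p x * p y)
  (p1_gt0 : 0 < p 1).

Let p0 : p 0 = 0.
Proof. by rewrite -(scale0r 0) pZ normc0 mul0r. Qed.

Let pN x : p (- x) = p x.
Proof. by rewrite -scaleN1r pZ normcN normc1 mul1r. Qed.

Let p_ge0 x : 0 <= p x.
Proof. by have := pD x (- x); rewrite subrr p0 pN; lra. Qed.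

(** [kerD], [kerM] and [kerN] make the kernel of [p] an ideal, so [p (x - y) = 0] can stand for
    equality in a quotient algebra that is never formed. *)
Let kerD x y : p x = 0 -> p y = 0 -> p (x + y) = 0.
Proof. by move=> x0 y0; apply: le_anti; rewrite p_ge0 (le_trans (pD _ _))// x0 y0 addr0. Qed.

Let kerM x y : p y = 0 -> p (x * y) = 0.
Proof. by move=> y0; apply: le_anti; rewrite p_ge0 (le_trans (pM _ _))// y0 mulr0. Qed.

Let kerN x : p x = 0 -> p (- x) = 0.
Proof. by rewrite pN. Qed.

Let p_congr x y : p (x - y) = 0 -> p x = p y.
Proof.
move=> xy0; have := pD (x - y) y; have := pD (y - x) x.
by rewrite !subrK -(opprB x y) pN xy0 !add0r => yx xy; apply: le_anti; rewrite xy yx.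
Qed.

Let p_expM x y n : p (x ^+ n * y) <= p x ^+ n * p y.
Proof.
elim: n => [|n IHn]; first by rewrite !expr0 !mul1r.
by rewrite !exprS -!mulrA (le_trans (pM _ _))// ler_wpM2l.
Qed.

Let p_sum n (F : 'I_n -> A) : p (\sum_i F i) <= \sum_i p (F i).
Proof.
elim/big_ind2 : _ => [|x u y v xu yv|//]; first by rewrite p0.
by rewrite (le_trans (pD _ _))// lerD.
Qed.

(** * The resolvent of an element modulo the kernel of [p] *)

Section Resolvent.
Variables (a : A) (r : R[i] -> A).
Hypothesis rP : forall k, p (r k * (a - k%:A) - 1) = 0.
Local Notation g k := (p (r k)).

Let g_gt0 k : 0 < g k.
Proof.
rewrite lt_neqAle p_ge0 andbT eq_sym; apply: contraTneq p1_gt0 => gk0.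
by rewrite -leNgt -(p_congr (rP k)) mulrC kerM.
Qed.

(** The resolvent identity [r l - r k = (l - k) * r k * r l] holds modulo the kernel. Dividing by
    [g k * g l] makes [1 / g] 1-Lipschitz. *)
Let resolvent_lipschitz k l : g l - g k <= normc (k - l) * (g k * g l).
Proof.
have E : p (r l - (r k + (l - k)%:A * (r k * r l))) = 0.
  have -> : r l - (r k + (l - k)%:A * (r k * r l)) =
      r k * (r l * (a - l%:A) - 1) + (- (r l * (r k * (a - k%:A) - 1))).
    by rewrite scalerBl; ring.
  by rewrite kerD ?kerN ?kerM.
rewrite lerBlDl [leLHS](p_congr E) (le_trans (pD _ _))// lerD2l mulr_algl pZ.
by rewrite -normcN opprB ler_wpM2l ?pM ?normc_ge0.
Qed.

(** Modulo the kernel, [k *: r k = a * r k - 1]. This makes [1 / g] coercive. *)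
Let resolvent_bound k : (normc k - p a) * g k <= p 1.
Proof.
rewrite mulrBl lerBlDl -pZ -mulr_algl.
have E : p (k%:A * r k - (r k * a + (- 1))) = 0.
  rewrite (_ : _ - _ = - (r k * (a - k%:A) - 1)) ?kerN//; ring.
by rewrite (p_congr E) (le_trans (pD _ _))// pN lerD2r mulrC pM.
Qed.

Let resolvent_max : exists l, forall k, g k <= g l.
Proof.
have [|k l|k|l lmin] := @normc_coercive_min R (fun k => (g k)^-1) (p 1)^-1 (p a).
- by rewrite invr_gt0.
- have [gk gl] := (g_gt0 k, g_gt0 l); rewrite -[leLHS]mulr1.
  have -> : (g k)^-1 - (g l)^-1 = (g l - g k) / (g k * g l).
    by field; rewrite !gt_eqF.
  by rewrite mulr1 ler_pdivrMr ?mulr_gt0.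
- by rewrite -[leRHS]mul1r ler_pdivlMr// -mulrA ler_pdivrMl// mulr1.
- by exists l => k; rewrite -lef_pV2 ?posrE.
Qed.

(* Modulo the kernel of p, each resolvent value x_j = r (l + w^j mu) satisfies
   (1 - w^j z) x_j = r l with z = mu *: r l.  Multiplying by the geometric sum of
   w^j z and summing over j, only the constant term of the sum survives. *)
Let mean_value n w l mu : (0 < n)%N -> n.-primitive_root w ->
  p ((1 - (mu *: r l) ^+ n) * (\sum_(j < n) r (l + w ^+ j * mu)) - n%:R * r l) = 0.
Proof.
move=> n0 wn; set z := mu *: r l.
have E1 j : p ((1 - (w ^+ j)%:A * z) * r (l + w ^+ j * mu) - r l) = 0.
  rewrite /z -[mu *: r l]mulr_algl; set x := r (l + _).
  have -> : (1 - (w ^+ j)%:A * (mu%:A * r l)) * x - r l =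
      r l * (x * (a - (l + w ^+ j * mu)%:A) - 1) + - (x * (r l * (a - l%:A) - 1)).
    by rewrite scalerDl -scalerA -[w ^+ j *: mu%:A]mulr_algl; ring.
  by rewrite kerD ?kerN// kerM// rP.
have E2 j : p ((1 - z ^+ n) * r (l + w ^+ j * mu) -
               (\sum_(i < n) (w ^+ j *: z) ^+ i) * r l) = 0.
  rewrite (_ : _ - _ = (\sum_(i < n) (w ^+ j *: z) ^+ i) *
    ((1 - (w ^+ j)%:A * z) * r (l + w ^+ j * mu) - r l)); first exact: kerM.
  rewrite mulrBr mulrA; congr (_ * _ - _); rewrite mulr_algl mulrC.
  rewrite -[LHS]opprK opprB -[X in X - 1](_ : (w ^+ j *: z) ^+ n = _); last first.
    by rewrite exprZn exprAC (prim_expr_order wn) expr1n scale1r.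
  by rewrite subrX1 -mulNr opprB.
have -> : n%:R = \sum_(j < n) \sum_(i < n) (w ^+ j *: z) ^+ i :> A.
  rewrite exchange_big /= (bigD1 (Ordinal n0)) //= [X in _ + X]big1 ?addr0.
    by rewrite sumr_const card_ord.
  move=> i i0; under eq_bigr do rewrite exprZn -exprM.
  rewrite -scaler_suml (sum_prim_root_exp wn) ?scale0r//.
  by rewrite ltn_ord andbT lt0n; exact: i0.
rewrite mulr_sumr mulr_suml -sumrB.
by elim/big_ind : _ => [|x y|j _] //; exact: kerD.
Qed.

(* With n points on the circle, one of which is mu itself, a deficit d of g at
   l + mu lowers the average of g by d / n, whereas the average is within
   O(2^-n) of the maximum: so d = O(n / 2^n) for all n. *)
Let max_propagates l mu : (forall k, g k <= g l) ->
  normc mu * g l <= 2^-1 -> g (l + mu) = g l.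
Proof.
move=> lmax mul; set M := g l.
have key n : (0 < n)%N -> (M - g (l + mu)) <= 2^-1 ^+ n * (n%:R * M).
  move=> n0; have [w wn] := primitive_root_exists R[i] n0.
  have /p_congr := mean_value l mu n0 wn; set X := \sum_(j < n) _ => E.
  (* The term [j = 0] is [g (l + mu)]; each other term is bounded by [M]. *)
  have pX : p X <= n%:R * M - (M - g (l + mu)).
    apply: le_trans (p_sum _) _; rewrite (bigD1 (Ordinal n0))//= expr0 mul1r.
    rewrite opprB addrCA lerD2l.
    have -> : n%:R * M - M = \sum_(j < n | j != Ordinal n0) M.
      by rewrite -[in LHS](card_ord n) mulr_natl -sumr_const (bigD1 (Ordinal n0))//= addrC addrK.
    exact: ler_sum.
  (* The power in [mean_value] contributes the factor [2^-n], as [p (mu *: r l) <= 1/2]. *)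
  have : n%:R * M <= (1 + 2^-1 ^+ n) * p X.
    have -> : n%:R * M = p (n%:R * r l).
      by rewrite [in RHS]mulr_natl -[in RHS]scaler_nat pZ normcMn normc1.
    rewrite -E mulrBl mul1r (le_trans (pD _ _))// pN mulrDl mul1r lerD2l.
    rewrite (le_trans (p_expM _ _ _))// ler_wpM2r// lerXn2r ?nnegrE//.
    by rewrite pZ.
  have : (0 : R) <= 2^-1 ^+ n by rewrite exprn_ge0.
  have := lmax (l + mu); rewrite -/M => ? t0.
  (* With [d = M - g (l + mu) >= 0] and [t = 2^-n], [n M <= (1 + t) (n M - d)] yields
     [d <= t n M]. *)
  by move: (2^-1 ^+ n) t0 => t t0 /le_trans/(_ (ler_wpM2l _ pX)) H; have := H; nra.
apply: le_anti; rewrite lmax /=.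
rewrite leNgt; apply/negP; rewrite -subr_gt0 => d0.
have M0 : 0 < M := g_gt0 l.
(* Using [key] at [2 m] together with [m / 2^m <= 1] gives [m d <= 2 M] for the deficit [d], which
   this [m] violates. *)
have [m mP] : exists m : nat, 2 * M / (M - g (l + mu)) < m%:R.
  by exists (Num.truncn (2 * M / (M - g (l + mu)))).+1; exact: truncnS_gt.
have m0 : (0 < m)%N.
  by rewrite -(ltr0n R) (le_lt_trans _ mP)// divr_ge0 ?mulr_ge0 ?(ltW M0)// ltW.
have : 2^-1 ^+ m * m%:R <= 1 :> R.
  by rewrite exprVn ler_pdivrMl ?exprn_gt0// mulr1 -natrX ler_nat ltnW// ltn_expl.
have := key (m * 2)%N; rewrite muln_gt0 m0 exprM natrM => /(_ isT).
have t0 : (0 : R) <= 2^-1 ^+ m by rewrite exprn_ge0.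
have m0' : (0 : R) < m%:R by rewrite ltr0n.
move: mP; rewrite ltr_pdivrMr// => mP keym tm.
have : (2^-1 ^+ m * m%:R) ^+ 2 <= 1 :> R by rewrite expr_le1// mulr_ge0.
move=> tm2; have := ler_wpM2l (ltW m0') keym.
have := ler_wpM2r (ltW M0) tm2; lra.
Qed.

Lemma no_resolvent : False.
Proof.
have [l lmax] := resolvent_max.
(* [t] is the radius allowed by [max_propagates]. Each step keeps the value [g l], so the same
   radius serves again. *)
have g0 := g_gt0 l; set t := (2 * g l)^-1.
have it n : g (l + (n%:R * t)%:C) = g l.
  elim: n => [|n IHn]; first by rewrite mul0r addr0.
  rewrite -natr1 mulrDl mul1r rmorphD addrA /=.
  rewrite max_propagates// => [k|]; rewrite IHn//.
  rewrite normc_real ger0_norm ?invr_ge0 ?mulr_ge0 ?(ltW g0)//.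
  by rewrite /t invfM mulfVK ?gt_eqF.
(* For [n > B], [resolvent_bound] fails at [l + n t], since [normc (l + n t) >= n t - normc l] and
   [t * g l = 1/2]. *)
pose B := 2 * (p 1 + (p a + normc l) * g l).
have B0 : 0 <= B.
  by rewrite /B mulr_ge0// addr_ge0 ?(ltW p1_gt0)// mulr_ge0 ?addr_ge0 ?normc_ge0 ?(ltW g0).
have nB := truncnS_gt B; set n := _.+1 in nB.
have := resolvent_bound (l + (n%:R * t)%:C); rewrite it leNgt => /negP; apply.
have : n%:R * t <= normc (l + (n%:R * t)%:C) + normc l.
  rewrite -[normc l]normcN (le_trans _ (le_normcD _ _))// addrAC subrr add0r.
  by rewrite normc_real ler_norm.
have tg : t * g l = 2^-1 by rewrite /t invfM mulfVK ?gt_eqF.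
set c := normc (_ + _) => cP.
have := ler_wpM2r (ltW g0) cP; rewrite -mulrA tg; move: nB; rewrite /B; lra.
Qed.

End Resolvent.
End SeminormedAlgebra.

(** * The norm with values in [R], and the Neumann series *)

Section RealNorm.
Variables (R : realType) (A : comBanachAlg R[i]).
Implicit Types x y : A.

Definition rnorm x : R := complex.Re `|x|.

Lemma rnormE x : `|x| = (rnorm x)%:C.
Proof. by rewrite [RHS]RRe_real ?normr_real. Qed.

Lemma rnorm_ge0 x : 0 <= rnorm x.
Proof. by rewrite -ler0c -rnormE. Qed.

Lemma rnormD x y : rnorm (x + y) <= rnorm x + rnorm y.
Proof. by rewrite -lecR rmorphD /= -!rnormE ler_normD. Qed.

Lemma rnormN x : rnorm (- x) = rnorm x.
Proof. by rewrite /rnorm normrN. Qed.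

Lemma rnormM x y : rnorm (x * y) <= rnorm x * rnorm y.
Proof. by rewrite -lecR rmorphM /= -!rnormE normrM_le. Qed.

Lemma normr_normc (k : R[i]) : `|k| = (normc k)%:C.
Proof. by case: k. Qed.

Lemma rnormZ (k : R[i]) x : rnorm (k *: x) = normc k * rnorm x.
Proof. by apply: complexI; rewrite rmorphM /= -!rnormE normrZ normr_normc. Qed.

(** The factor [rnorm 1], which may differ from 1, accounts for [n = 0]. *)
Lemma rnorm_exp x n : rnorm (x ^+ n) <= rnorm 1 * rnorm x ^+ n.
Proof.
elim: n => [|n IHn]; first by rewrite !expr0 mulr1.
by rewrite !exprS (le_trans (rnormM _ _))// mulrCA ler_wpM2l// rnorm_ge0.
Qed.

(** The inverse of [1 - x] is the limit of the geometric series, whose partial sums are Cauchy. *)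
Lemma neumann x : rnorm x < 1 -> exists y, (1 - x) * y = 1.
Proof.
move=> x1; pose q := rnorm x; pose C := rnorm (1 : A) / (1 - q).
have q0 : 0 <= q := rnorm_ge0 x.
pose s n : A := \sum_(i < n) x ^+ i.
(* The factor [1 - q ^+ m] closes the induction: its increment is exactly the bound on the added
   term. *)
have sdist n m : rnorm (s (n + m)%N - s n) <= C * q ^+ n * (1 - q ^+ m).
  elim: m => [|m IHm].
    by rewrite addn0 !subrr mulr0 /rnorm normr0.
  rewrite addnS /s big_ord_recr /= addrAC (le_trans (rnormD _ _))//.
  apply: le_trans (lerD IHm (rnorm_exp _ _)) _; rewrite -/q exprD exprS.
  have -> : rnorm (1 : A) = C * (1 - q) by rewrite divfK// subr_eq0 gt_eqF.
  by rewrite le_eqVlt; apply/orP; left; apply/eqP; ring.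
have C0 : 0 <= C by rewrite divr_ge0 ?rnorm_ge0// subr_ge0 ltW.
have sdist' n m : (n <= m)%N -> rnorm (s m - s n) <= C * q ^+ n.
  move=> nm; rewrite -(subnKC nm) (le_trans (sdist _ _))// -[leRHS]mulr1.
  by apply: ler_wpM2l; [rewrite mulr_ge0 ?exprn_ge0|rewrite gerBl exprn_ge0].
have small e : 0 < e -> exists n, C * q ^+ n < e.
  move=> e0.
  have : (fun n => C * q ^+ n) @ \oo --> C * 0.
    by apply: cvgM; [exact: cvg_cst|apply: cvg_expr; rewrite ger0_norm].
  rewrite mulr0 => /cvgrPdist_lt/(_ e e0)[N _ /(_ N (leqnn N))] /=.
  by rewrite sub0r normrN => /(le_lt_trans (ler_norm _)) ?; exists N.
have : cvg (s @ \oo).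
  apply/cauchy_cvgP/cauchy_exP => e e0.
  have eE : e = (complex.Re e)%:C by rewrite RRe_real ?gtr0_real.
  rewrite eE ltcR in e0; have [n nP] := small _ e0.
  exists (s n), n => // m nm; rewrite eE -ball_normE /= distrC rnormE ltcR.
  exact: le_lt_trans (sdist' _ _ nm) nP.
move=> /cvg_ex[y /cvgrPdist_lt sy]; exists y.
suff : rnorm ((1 - x) * y - 1) <= 0.
  by rewrite -lecR -rnormE normr_le0 subr_eq0 => /eqP.
pose K := rnorm (1 - x); have K0 : 0 <= K := rnorm_ge0 _.
have le e : 0 < e -> rnorm ((1 - x) * y - 1) <= (K + 1) * e.
  move=> e0; have [n nP] := small _ e0.
  have [|N _ /(_ (maxn n N) (leq_maxr _ _))] := sy e%:C; first by rewrite ltcR.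
  set m := maxn n N; rewrite rnormE ltcR => ym.
  (* The error splits into a convergence error, small as [m >= N], and a power of [x], small as
     [m >= n]. *)
  have -> : (1 - x) * y - 1 = (1 - x) * (y - s m) - x ^+ m.
    have : (1 - x) * s m = 1 - x ^+ m.
      by rewrite -[RHS]opprB subrX1 -mulNr opprB.
    by rewrite mulrBr => ->; ring.
  rewrite [leRHS]mulrDl mul1r (le_trans (rnormD _ _))// rnormN lerD//.
    by rewrite (le_trans (rnormM _ _))// ler_wpM2l// ltW.
  apply: le_trans (rnorm_exp _ _) _; apply: le_trans (ltW nP).
  rewrite (le_trans (_ : _ <= C * q ^+ m))//.
    rewrite ler_wpM2r ?exprn_ge0// ler_pdivlMr ?subr_gt0//.
    by rewrite ler_piMr ?rnorm_ge0// gerBl.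
  by rewrite ler_wpM2l// ler_wiXn2l ?leq_maxl// ltW.
rewrite leNgt; apply/negP => d0.
(* For this [e], [le] bounds the norm by half of itself. *)
have /le : 0 < rnorm ((1 - x) * y - 1) / (K + 1) / 2.
  by rewrite !divr_gt0// ltr_wpDl.
have K1 : K + 1 != 0 by rewrite gt_eqF// ltr_wpDl.
have -> : (K + 1) * (rnorm ((1 - x) * y - 1) / (K + 1) / 2) =
    rnorm ((1 - x) * y - 1) / 2 by field.
by move: d0; lra.
Qed.

End RealNorm.

(** * The seminorm on [A] induced by an ideal *)

Section QuotientSeminorm.
Variables (R : realType) (A : comBanachAlg R[i]) (I : set A).
Hypothesis idealI : is_ideal I.
Implicit Types x y u v : A.

Let I0 : I 0. Proof. by case: idealI. Qed.

Let ID u v : I u -> I v -> I (u + v).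
Proof. by case: idealI => _ + _; apply. Qed.

Let IM x u : I u -> I (x * u).
Proof. by case: idealI => _ _; apply. Qed.

Let IN u : I u -> I (- u).
Proof. by rewrite -mulN1r; exact: IM. Qed.

Let IZ k u : I u -> I (k *: u).
Proof. by rewrite -mulr_algl; exact: IM. Qed.

Definition quot_norm x : R := inf [set rnorm (x - u) | u in I].

Lemma quot_norm_le x u : I u -> quot_norm x <= rnorm (x - u).
Proof.
move=> Iu; apply: ge_inf; last by exists u.
by exists 0 => _ [v _ <-]; exact: rnorm_ge0.
Qed.

Lemma quot_norm_ge x c : (forall u, I u -> c <= rnorm (x - u)) -> c <= quot_norm x.
Proof.
move=> cle; apply: lb_le_inf; first by exists (rnorm (x - 0)), 0.
by move=> _ [u Iu <-]; exact: cle.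
Qed.

Let quot_norm_ge0 x : 0 <= quot_norm x.
Proof. by apply: quot_norm_ge => u _; exact: rnorm_ge0. Qed.

(** Pulling a factor out of the infimum lets [quot_normM] treat one factor at a time. For [k = 0],
    the choice [u = 0] suffices. *)
Let quot_norm_ge_scaled x c k : 0 <= k ->
  (forall u, I u -> c <= k * rnorm (x - u)) -> c <= k * quot_norm x.
Proof.
rewrite le_eqVlt => /predU1P[<- /(_ 0 I0)|k0 cle]; first by rewrite !mul0r.
rewrite -ler_pdivrMl//; apply: quot_norm_ge => u Iu.
by rewrite ler_pdivrMl// cle.
Qed.

Lemma quot_norm0 x : I x -> quot_norm x = 0.
Proof.
move=> Ix; apply: le_anti; rewrite quot_norm_ge0 andbT.
by rewrite (le_trans (quot_norm_le _ Ix))// subrr /rnorm normr0.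
Qed.

Lemma quot_normD x y : quot_norm (x + y) <= quot_norm x + quot_norm y.
Proof.
rewrite -lerBlDr; apply: quot_norm_ge => u Iu.
rewrite lerBlDr -lerBlDl; apply: quot_norm_ge => v Iv; rewrite lerBlDl.
apply: le_trans (quot_norm_le _ (ID Iu Iv)) _.
by rewrite (_ : _ - _ = (x - u) + (y - v)) ?rnormD//; ring.
Qed.

Lemma quot_normM x y : quot_norm (x * y) <= quot_norm x * quot_norm y.
Proof.
apply: quot_norm_ge_scaled => // v Iv; rewrite [leRHS]mulrC.
apply: quot_norm_ge_scaled => [|u Iu]; first exact: rnorm_ge0.
(* This element is [x * y - (x - u) * (y - v)]. *)
have Iw : I (x * v + y * u - u * v) by apply: ID; [apply: ID|apply: IN]; exact: IM.
apply: le_trans (quot_norm_le _ Iw) _; rewrite [leRHS]mulrC.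
by rewrite (_ : _ - _ = (x - u) * (y - v)) ?rnormM//; ring.
Qed.

Let quot_normZ_le k x : quot_norm (k *: x) <= normc k * quot_norm x.
Proof.
apply: quot_norm_ge_scaled => [|u Iu]; first exact: normc_ge0.
by rewrite (le_trans (quot_norm_le _ (IZ k Iu)))// -scalerBr rnormZ.
Qed.

Lemma quot_normZ k x : quot_norm (k *: x) = normc k * quot_norm x.
Proof.
apply: le_anti; rewrite quot_normZ_le /=; have [->|k0] := eqVneq k 0.
  by rewrite normc0 mul0r.
have := quot_normZ_le k^-1 (k *: x); rewrite scalerA mulVf// scale1r normcV.
rewrite ler_pdivlMl// lt_neqAle normc_ge0 andbT eq_sym.
by apply: contra_neq k0; exact: eq0_normc.
Qed.

Hypothesis I1 : ~ I 1.

(** If [u] in [I] had [rnorm (1 - u) < 1], then [u] would be invertible and [1] would lie in [I]; so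
    the value is at least 1. *)
Lemma quot_norm1_gt0 : 0 < quot_norm 1.
Proof.
apply: lt_le_trans ltr01 _; apply: quot_norm_ge => u Iu; rewrite leNgt; apply/negP.
move=> /neumann[y]; rewrite opprB addrCA subrr addr0 => uy.
by apply: I1; rewrite -uy mulrC; exact: IM.
Qed.

(** If [normc k > rnorm a], then [1 - k^-1 *: a] is invertible, yet it is a multiple of [a - k%:A]
    and so lies in [I]. *)
Lemma residue_norm_le a k : I (a - k%:A) -> normc k <= rnorm a.
Proof.
move=> Iak; rewrite leNgt; apply/negP => ak.
have k0 : k != 0.
  by apply: contraTneq ak => ->; rewrite normc0 -leNgt rnorm_ge0.
have [|y yP] := @neumann _ A (k^-1 *: a).
  rewrite rnormZ normcV mulrC ltr_pdivrMr ?mul1r//.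
  exact: le_lt_trans (rnorm_ge0 _) ak.
apply: I1; rewrite -yP mulrC; apply: IM.
rewrite (_ : 1 - _ = - (k^-1 *: (a - k%:A))); first by apply: IN; apply: IZ.
by rewrite scalerBr scalerA mulVf// scale1r opprB.
Qed.

(** Otherwise every [a - k%:A] is invertible modulo [I], and a choice of inverses is a resolvent
    excluded by [no_resolvent]. *)
Lemma gelfand_mazur a : (forall x, ~ I x -> exists y, I (y * x - 1)) ->
  exists k : R[i], I (a - k%:A).
Proof.
move=> Iinv; apply: contrapT => /forallNP aP.
have /choice[r rP] k : exists y, I (y * (a - k%:A) - 1) by exact: Iinv.
apply: (no_resolvent quot_normD quot_normZ quot_normM quot_norm1_gt0 (a := a) (r := r)).
by move=> k; exact: quot_norm0.
Qed.

End QuotientSeminorm.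

(** * Maximal submodules *)

Lemma ex_maximal_submodule (K : numFieldType) (A : comBanachAlg K)
    (M : banachModule A) n (e : 'I_n -> M) (N : set M) :
  (forall X : set M, is_submodule X -> (forall i, X (e i)) -> X = setT) ->
  is_submodule N -> N <> setT ->
  exists P : set M, [/\ is_submodule P, P <> setT, N `<=` P &
    forall Q : set M, is_submodule Q -> P `<=` Q -> Q = P \/ Q = setT].
Proof.
move=> gen Nsub Nproper.
pose good (X : set M) := [/\ is_submodule X, X <> setT & N `<=` X].
have [F Fgood Ftot|P [Pgood Pmax]] :=
    @Zorn_bigcup M [set X | X = set0 \/ good X].
  have [[X0 FX0 gX0]|none] := pselect (exists2 X, F X & good X); last first.
    left; rewrite -subset0 => x [X FX Xx].
    by case: (Fgood X FX) => [X0|gX]; [rewrite -X0|case: none; exists X].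
  have Fsub X x : F X -> X x -> good X.
    by move=> /Fgood [->|].
  have [X0sub _ NX0] := gX0; have [X00 _ _ _] := X0sub.
  right; split.
  - split.
    + by exists X0.
    + move=> x y [X FX Xx] [Y FY Yy].
      have [_ DX _ _] := let: And3 s _ _ := Fsub X x FX Xx in s.
      have [_ DY _ _] := let: And3 s _ _ := Fsub Y y FY Yy in s.
      case: (Ftot X Y FX FY) => [XY|YX].
        by exists Y => //; apply: DY => //; exact: XY.
      by exists X => //; apply: DX => //; exact: YX.
    + move=> k x [X FX Xx]; exists X => //.
      by have [_ _ + _] := let: And3 s _ _ := Fsub X x FX Xx in s; apply.
    + move=> a x [X FX Xx]; exists X => //.
      by have [_ _ _ +] := let: And3 s _ _ := Fsub X x FX Xx in s; apply.
  - move=> FT.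
    (* As the generators are finitely many, a single member of the chain contains them all. *)
    have [X [FX gX eX]] : exists X, [/\ F X, good X & forall i, i \in enum 'I_n -> X (e i)].
      elim: (enum 'I_n) => [|i s [X [FX gX sX]]]; first by exists X0; split.
      have [Y FY Yi] : (\bigcup_(X in F) X) (e i) by rewrite FT.
      have gY := Fsub _ _ FY Yi.
      case: (Ftot X Y FX FY) => [XY|YX].
        exists Y; split=> // j; rewrite inE => /predU1P[->//|/sX/XY//].
      by exists X; split=> // j; rewrite inE => /predU1P[->|/sX//]; exact: YX.
    have [Xsub XT _] := gX; apply: XT; apply: gen => // i.
    by apply: eX; rewrite mem_enum.
  - by move=> x Nx; exists X0 => //; exact: NX0.
have NN : good N by split.
(* The maximal element is not empty, since [N] is good and contains 0. *)
case: Pgood => [P0|[Psub PT NP]].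
  have [N0 _ _ _] := Nsub; case: (Pmax N); last by right.
  by rewrite P0; split=> [x []|/(_ _ N0)].
exists P; split=> // Q Qsub PQ; have [->|QP] := pselect (Q = P); first by left.
right; apply: contrapT => QT; apply: (Pmax Q); last first.
  by right; split=> //; exact: subset_trans PQ.
by rewrite properEneq; split=> //; apply/eqP => PQ'; apply: QP.
Qed.

Section MaximalSubmodule.
Variables (R : realType) (A : comBanachAlg R[i]) (M : banachModule A) (P : set M).
Hypotheses (act1 : forall m : M, act 1 m = m) (Psub : is_submodule P) (PT : P <> setT)
  (Pmax : forall Q : set M, is_submodule Q -> P `<=` Q -> Q = P \/ Q = setT).
Implicit Types (a b : A) (m x y : M).

Let P0 : P 0. Proof. by case: Psub. Qed.
Let PD x y : P x -> P y -> P (x + y). Proof. by case: Psub => _ + _ _; apply. Qed.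
Let PZ (k : R[i]) x : P x -> P (k *: x). Proof. by case: Psub => _ _ + _; apply. Qed.
Let PA a x : P x -> P (act a x). Proof. by case: Psub => _ _ _; apply. Qed.
Let PN x : P x -> P (- x). Proof. by rewrite -scaleN1r; exact: PZ. Qed.
Let PB x y : P x -> P y -> P (x - y). Proof. by move=> Px Py; apply: PD => //; exact: PN. Qed.

Let act0 m : act 0 m = 0.
Proof. by rewrite -(scale0r (0 : A)) actZl scale0r. Qed.

Let actN a m : act (- a) m = - act a m.
Proof. by rewrite -scaleN1r actZl scaleN1r. Qed.

Let actB a b m : act (a - b) m = act a m - act b m.
Proof. by rewrite actDl actN. Qed.

Let actK (k : R[i]) m : act k%:A m = k *: m.
Proof. by rewrite actZl act1. Qed.

(** The submodule [P + A v] strictly contains [P], so by maximality it is everything. *)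
Let generated v : ~ P v -> forall m, exists a, P (m - act a v).
Proof.
move=> Pv m; pose Q : set M := [set m | exists a, P (m - act a v)].
have Qsub : is_submodule Q.
  split.
  - by exists 0; rewrite act0 subr0.
  - move=> x y [a xa] [b yb]; exists (a + b).
    by rewrite actDl opprD addrACA; exact: PD.
  - move=> k x [a xa]; exists (k *: a).
    by rewrite actZl -scalerBr; exact: PZ.
  - move=> b x [a xa]; exists (b * a); rewrite actM.
    have := PA b xa; rewrite actDr -(scaleN1r (act a v)) actZr scaleN1r; exact.
have PQ : P `<=` Q by move=> x Px; exists 0; rewrite act0 subr0.
case: (Pmax Qsub PQ) => [QP|QT]; last by have : Q m by rewrite QT.
by exfalso; apply: Pv; rewrite -QP; exists 1; rewrite act1 subrr.
Qed.

Lemma maximal_submodule_character : exists v, exists chi : A -> R[i],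
  [/\ forall m, exists! k : R[i], P (m - k *: v),
      forall a m, P (act a m - chi a *: m) &
      forall a, `|chi a| <= `|a|].
Proof.
have [v Pv] : exists v, ~ P v.
  by apply: contrapT => /forallNP Pv; apply: PT; rewrite -subTset => x _; exact: contrapT.
pose I : set A := [set a | P (act a v)].
have idealI : is_ideal I.
  split.
  - by rewrite /I /= act0.
  - by move=> a b Ia Ib; rewrite /I /= actDl; exact: PD.
  - by move=> a b Ib; rewrite /I /= actM; exact: PA.
have I1 : ~ I 1 by rewrite /I /= act1.
(* If [a v] is outside [P], it generates [v] modulo [P], and the coefficient inverts [a] modulo
   [I]. *)
have Iinv a : ~ I a -> exists b, I (b * a - 1).
  move=> /generated/(_ v)[b Pb]; exists b.
  by rewrite /I /= actB act1 actM -opprB; exact: PN.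
have /choice[chi chiP] a : exists k : R[i], I (a - k%:A) by exact: gelfand_mazur.
(* By commutativity, an element killing the generator [v] modulo [P] kills every [b v]. *)
have IM a m : I a -> P (act a m).
  move=> Ia; have [b Pb] := generated Pv m.
  rewrite -(subrK (act b v) m) actDr; apply: PD; first exact: PA.
  by rewrite -actM mulrC actM; exact: PA.
exists v, chi; split.
- move=> m; have [a Pa] := generated Pv m; exists (chi a); split.
    have := PD Pa (chiP a); rewrite actB actK addrA subrK; exact.
  move=> k Pk; apply/eqP; rewrite -subr_eq0; apply/negP => /negP d0; apply: Pv.
  have Pd : P ((chi a - k) *: v).
    have := PB Pk (PD Pa (chiP a)); rewrite actB actK addrA subrK.
    by rewrite opprB addrC addrA subrK -scalerBl.
  by have := PZ (chi a - k)^-1 Pd; rewrite scalerA mulVf ?scale1r.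
- by move=> a m; rewrite -actK -actB; exact: IM.
- by move=> a; rewrite normr_normc rnormE lecR; exact: residue_norm_le (chiP a).
Qed.

End MaximalSubmodule.

(** * Closedness of maximal submodules of the free module *)

Lemma free_module_nice (R : realType) (A : comBanachAlg R[i]) n :
  nice (free_module A n).
Proof.
move=> N Nsub _ NT; pose M := free_module A n.
pose e (i : 'I_n) : M := \row_j (i == j)%:R.
have decomp (x : freemod A n) : x = \sum_i fm_act (x ord0 i) (e i).
  apply/rowP => j; rewrite summxE (bigD1 j)//= big1 => [|i ij].
    by rewrite !mxE eqxx mulr1 addr0.
  by rewrite !mxE (negPf ij) mulr0.
have submod_sum (X : set M) (f : 'I_n -> M) :
    is_submodule X -> (forall i, X (f i)) -> X (\sum_i f i).
  by move=> [X0 XD _ _] Xf; elim/big_ind : _.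
have gen (X : set M) : is_submodule X -> (forall i, X (e i)) -> X = setT.
  move=> Xsub Xe; rewrite -subTset => x _; rewrite (decomp x).
  by apply: (submod_sum X) => // i; case: Xsub => _ _ _; apply.
have [P [Psub PT NP Pmax]] := ex_maximal_submodule gen Nsub NT.
have act1 (m : M) : act 1 m = m by apply/rowP => i; rewrite !mxE mul1r.
have [v [chi [vP chiP chi_le]]] := maximal_submodule_character act1 Psub PT Pmax.
exists P; split=> //; last by exists v.
have /choice[c cP] i : exists k : R[i], P (e i - k *: v).
  by have [k [Pk _]] := vP (e i); exists k.
have [P0 PD PZ PA] := Psub.
have PN x : P x -> P (- x) by rewrite -scaleN1r; exact: PZ.
pose C := \sum_i `|c i|.
have C0 : 0 <= C by exact: sumr_ge0.
(* The coefficient of [z] along [v] modulo [P] is unique, hence is the sum of the coefficients of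
   the [z_i e_i]; [chi_le] then bounds it. *)
have bound (z : M) (k : R[i]) : P (z - k *: v) -> `|k| <= C * `|z|.
  move=> Pk; have -> : k = \sum_i chi ((z : freemod A n) ord0 i) * c i.
    have [l [_ lu]] := vP z; rewrite -(lu _ Pk); apply: lu.
    rewrite [X in P (X - _)](decomp z) scaler_suml -sumrB.
    apply: (submod_sum P) => // i.
    have := PD _ _ (chiP (z ord0 i) (e i)) (PZ (chi (z ord0 i)) _ (cP i)).
    by rewrite scalerBr addrA subrK scalerA.
  rewrite (le_trans (ler_norm_sum _ _ _))// mulr_suml ler_sum// => i _.
  rewrite normrM mulrC ler_wpM2l// (le_trans (chi_le _))//.
  exact: (@fm_norm_coord _ A n z i).
move=> x Px; have [k [Pk _]] := vP x.
have [k0|k0] := eqVneq k 0; first by rewrite k0 scale0r subr0 in Pk.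
(* A point [y] of [P] this close to [x] leaves [x - y] with the same coefficient [k], so [bound]
   gives [|k| < |k|]. *)
have e0 : 0 < `|k| / (C + 1) by rewrite divr_gt0 ?normr_gt0// ltr_wpDl.
have [y [Py]] := Px _ (nbhsx_ballx x _ e0).
rewrite -ball_normE /= ltr_pdivlMr ?ltr_wpDl// => xy.
have : `|k| <= C * `|x - y|.
  by apply: bound; rewrite addrAC; apply: PD => //; exact: PN.
have le : C * `|x - y| <= `|x - y| * (C + 1) by rewrite mulrDr mulr1 mulrC lerDl.
by move=> /le_trans/(_ le)/le_lt_trans/(_ xy); rewrite ltxx.
Qed.

Local Close Scope ring_scope.
Local Close Scope classical_set_scope.

Theorem proposition1p5 (R : realType) (A : comBanachAlg R[i]) (n : nat) :
  0 < n -> semisimple A -> nice (free_module A n).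
Proof. by move=> _ _; exact: free_module_nice. Qed.
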